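(* Let $(S,\cdot,\ast)$ be a regular $\star$-semigroup. Define binary operations $+$ and $\oplus$ on $S$ by $a+b=a^\ast b^\ast$ and $a\oplus b=b^\ast a^\ast$ for all $a,b\in S$. Let $r_S$ be the map associated to $(S,+,\cdot,\ast)$ (respectively, to $(S,\oplus,\cdot,\ast)$). In each of the two cases: if $r_S$ is a solution of the Yang-Baxter equation, then $(S,\cdot,\ast)$ is completely regular, orthodox and locally inverse; and if $x=x^\ast$ for all $x\in S$, then $r_S$ is a solution of the Yang-Baxter equation.
   Context: A regular $\star$-semigroup is a triple $(S,\cdot,\ast)$ where $(S,\cdot)$ is a semigroup on a non-empty set and $\ast:S\to S$, $x\mapsto x^\ast$, satisfies $xx^\ast x=x$, $(x^\ast)^\ast=x$, $(xy)^\ast=y^\ast x^\ast$ for all $x,y\in S$. It is called completely regular if $a\,\mathcal H\,a^2$ for all $a\in S$ ($\mathcal H=\mathcal L\cap\mathcal R$ being Green's relation), orthodox if the product of any two idempotents is idempotent, and locally inverse if $eSe$ is an inverse semigroup for every idempotent $e$. For a set $S$ with binary operations $+,\cdot$ ($+$ not necessarily associative) and a unary operation $\ast$, the map associated to $(S,+,\cdot,\ast)$ is $r_S:S\times S\to S\times S$, $r_S(a,b)=(a(a^{\ast}+b),\,(a^{\ast}+b)^{\ast}b)$; similarly with $\oplus$ in place of $+$. A map $r:S\times S\to S\times S$ is a (set-theoretic) solution of the Yang-Baxter equation if $(r\times \mathrm{id}_S)(\mathrm{id}_S\times r)(r\times \mathrm{id}_S)=(\mathrm{id}_S\times r)(r\times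 \mathrm{id}_S)(\mathrm{id}_S\times r)$ as maps $S^3\to S^3$. *)

(* Defs.v *)
From mathcomp Require Import all_boot.

Set Implicit Arguments.
Unset Strict Implicit.
Unset Printing Implicit Defensive.

Import Algebra.

Local Open Scope group_scope.

(* The carrier is a magmaType with associativity as a field, rather than a
   semigroupType, because the latter also requires a choiceType. *)
Record regular_star_semigroup (S : magmaType) (star : S -> S) : Prop := {
  rss_nonempty : inhabited S;
  rss_assoc    : associative (@mul S);
  rss_regular  : forall x : S, x * star x * x = x;
  rss_invol    : forall x : S, star (star x) = x;
  rss_antimul  : forall x y : S, star (x * y) = star y * star x
}.

(* The principal left ideal S^1 a, and the principal right ideal a S^1. *)
Definition lideal1 (S : magmaType) (a x : S) : Prop :=
  x = a \/ exists s : S, x = s * a.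
Definition rideal1 (S : magmaType) (a x : S) : Prop :=
  x = a \/ exists s : S, x = a * s.

Definition green_L (S : magmaType) (a b : S) : Prop :=
  forall x : S, lideal1 a x <-> lideal1 b x.
Definition green_R (S : magmaType) (a b : S) : Prop :=
  forall x : S, rideal1 a x <-> rideal1 b x.
Definition green_H (S : magmaType) (a b : S) : Prop :=
  green_L a b /\ green_R a b.

Definition completely_regular (S : magmaType) : Prop :=
  forall a : S, green_H a (a * a).

Definition idempotent_elt (S : magmaType) (e : S) : Prop := e * e = e.

Definition orthodox (S : magmaType) : Prop :=
  forall e f : S,
    idempotent_elt e -> idempotent_elt f -> idempotent_elt (e * f).

(* The subset T of S is closed under the product and is an inverse semigroup
   for it: each x in T has exactly one inverse y in T. *)
Definition inverse_subsemigroup (S : magmaType) (T : S -> Prop) : Prop :=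
  (forall x y : S, T x -> T y -> T (x * y)) /\
  (forall x : S, T x ->
     exists! y : S, T y /\ x * y * x = x /\ y * x * y = y).

Definition local_subsemigroup (S : magmaType) (e x : S) : Prop :=
  exists s : S, x = e * s * e.

Definition locally_inverse (S : magmaType) : Prop :=
  forall e : S, idempotent_elt e -> inverse_subsemigroup (local_subsemigroup e).

Definition star_add (S : magmaType) (star : S -> S) (a b : S) : S :=
  star a * star b.
Definition star_oplus (S : magmaType) (star : S -> S) (a b : S) : S :=
  star b * star a.

Definition associated_map (S : magmaType) (add : S -> S -> S) (star : S -> S)
    (p : S * S) : S * S :=
  let: (a, b) := p in
  (a * add (star a) b, star (add (star a) b) * b).

Definition map_times_id (S : Type) (r : S * S -> S * S) (t : S * S * S) :
    S * S * S :=
  let: (a, b, c) := t in let: (a', b') := r (a, b) in (a', b', c).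
Definition id_times_map (S : Type) (r : S * S -> S * S) (t : S * S * S) :
    S * S * S :=
  let: (a, b, c) := t in let: (b', c') := r (b, c) in (a, b', c').

Definition YBE_solution (S : Type) (r : S * S -> S * S) : Prop :=
  map_times_id r \o id_times_map r \o map_times_id r
  =1 id_times_map r \o map_times_id r \o id_times_map r.

(* Main.v *)
Require Import Defs.
From mathcomp Require Import all_boot.

(** Write d for b^*. For a + b = a^* b^* the map is
    r(a, b) = (a a b^*, b a^* b), and the first and third components of the
    Yang-Baxter equation at (a, d^*, c) are
      a a d a a d c d a d d a d = a a c d d,
      c d a d c = c d c c d d a c d d c d c.
    The second one with d = c^* and a = c gives c in c c S; applying this to c^*
    gives c in S c c, so S is completely regular. The first one at idempotents
    a = e, d = f reads e f e f c f e f e f = e c f; taking c = e and c = f gives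
    ef = (ef)^5 = (ef)^4, so ef is idempotent. It also shows that e c f lies in
    e f S and in S e f. If f, g are idempotents of eSe, then f g = e f g lies in
    e g S = g S and g f = g f e lies in S g e = S g, hence f g = g f g = g f.
    So idempotents of eSe commute, and eSe, being regular, is inverse.
    The operation b^* a^* leads to the same two equations read from right to
    left. *)

Import Algebra.
Local Open Scope group_scope.

Section RegularStarSemigroup.
Variables (S : magmaType) (star : S -> S).
Hypothesis hS : regular_star_semigroup star.
Let mulA : associative (@mul S) := rss_assoc hS.
Let starK := rss_invol hS.
Let starM := rss_antimul hS.
Let mul_starK := rss_regular hS.

(** The mirror factorization a = t a a comes from the hypothesis at [star a], since [star] reverses
    products. *)
Lemma completely_regular_of_square_factor :
  (forall c : S, exists s, c = c * c * s) -> completely_regular S.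
Proof.
move=> hr a; have [s es] := hr a.
have [t et] : exists t, a = t * (a * a).
  have [u eu] := hr (star a); exists (star u).
  by rewrite -{1}[a]starK eu !starM !starK.
split=> x; split.
- case=> [->|[u ->]]; right; first by exists t.
  by exists (u * t); rewrite -mulA -et.
- by case=> [->|[u ->]]; right; [exists a | exists (u * a); rewrite mulA].
- case=> [->|[u ->]]; right; first by exists s.
  by exists (s * u); rewrite mulA -es.
- by case=> [->|[u ->]]; right; [exists a | exists (a * u); rewrite !mulA].
Qed.

(** The four equations place f and g in eSe. In a regular semigroup, commuting idempotents force
    inverses to be unique. *)
Lemma locally_inverse_of_commuting :
  (forall e f g : S, idempotent_elt e -> idempotent_elt f -> idempotent_elt g ->
     e * f = f -> f * e = f -> e * g = g -> g * e = g -> f * g = g * f) ->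
  locally_inverse S.
Proof.
move=> hcomm e he.
have lunit x : local_subsemigroup e x -> e * x = x.
  by case=> s ->; rewrite !mulA he.
have runit x : local_subsemigroup e x -> x * e = x.
  by case=> s ->; rewrite -!mulA he.
have closed x y : local_subsemigroup e x -> local_subsemigroup e y ->
    local_subsemigroup e (x * y).
  move=> hx hy; exists (x * y).
  by rewrite mulA (lunit x hx) -mulA (runit y hy).
split=> // x hx.
have comm f g : local_subsemigroup e f -> local_subsemigroup e g ->
    idempotent_elt f -> idempotent_elt g -> f * g = g * f.
  by move=> hf hg If Ig; apply: (hcomm e) => //; auto.
have uniq y z : local_subsemigroup e y -> local_subsemigroup e z ->
    x * y * x = x -> y * x * y = y -> x * z * x = x -> z * x * z = z -> y = z.
  move=> hy hz xyx yxy xzx zxz.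
  (* Both x y and x z are idempotents of eSe; x y x = x = x z x shrinks the two commuted products to
     x y and x z. *)
  have exy : x * y = x * z.
    have : (x * z) * (x * y) = (x * y) * (x * z).
      by apply: comm; auto; rewrite /idempotent_elt mulA ?xyx ?xzx.
    by rewrite !mulA xyx xzx.
  have eyx : y * x = z * x.
    have : (y * x) * (z * x) = (z * x) * (y * x).
      by apply: comm; auto; rewrite /idempotent_elt mulA ?yxy ?zxz.
    by rewrite -!mulA [x * (z * x)]mulA [x * (y * x)]mulA xyx xzx.
  by rewrite -yxy eyx -mulA exy mulA.
(* [star x] may lie outside eSe; trimming it by e is harmless next to x, as e x = x = x e. *)
have local_star : local_subsemigroup e (e * star x * e) by exists (star x).
have xvx : x * (e * star x * e) * x = x.
  by rewrite !mulA (runit x hx) -mulA (lunit x hx) mul_starK.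
have vxv : e * star x * e * x * (e * star x * e) = e * star x * e.
  have hreg := mul_starK (star x); rewrite starK in hreg.
  rewrite !mulA -[_ * e * x]mulA (lunit x hx) -[_ * x * e]mulA (runit x hx).
  by rewrite -[e * _ * x]mulA -[e * _ * _]mulA hreg.
exists (e * star x * e); split=> // z [hz [xzx zxz]].
exact: uniq.
Qed.

Lemma locally_inverse_of_factorization :
  (forall e f c : S, idempotent_elt e -> idempotent_elt f ->
     (exists u, e * c * f = e * f * u) /\ (exists v, e * c * f = v * (e * f))) ->
  locally_inverse S.
Proof.
move=> hfac; apply: locally_inverse_of_commuting.
move=> e f g he hf hg ef fe eg ge.
have gfg_l : g * f * g = f * g.
  have [[u eu] _] := hfac e g f he hg.
  by rewrite ef eg in eu; rewrite -mulA eu mulA hg.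
have gfg_r : g * f * g = g * f.
  have [_ [v ev]] := hfac g e f hg he.
  by rewrite -[g * f * e]mulA fe ge in ev; rewrite ev -mulA hg.
by rewrite -gfg_l gfg_r.
Qed.

Lemma orthodox_locally_inverse_of_left_sandwich :
  (forall a c d : S, a * a * d * a * a * d * c * d * a * d * d * a * d
     = a * a * c * d * d) ->
  orthodox S /\ locally_inverse S.
Proof.
move=> hyp.
have sandwich (e f c : S) : idempotent_elt e -> idempotent_elt f ->
    e * c * f = e * f * e * f * c * f * e * f * e * f.
  move=> he hf; have := hyp e c f.
  have he' x : x * e * e = x * e by rewrite -mulA he.
  have hf' x : x * f * f = x * f by rewrite -mulA hf.
  by rewrite !he ?he' !hf'.
have orth : orthodox S.
  move=> e f he hf.
  have := sandwich e f e he hf; have := sandwich e f f he hf.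
  have hf' x : x * f * f = x * f by rewrite -mulA hf.
  rewrite !hf' he => p4 p5; rewrite /idempotent_elt.
  (* (ef)^2 = (ef)^4 (ef) = (ef)^5 = ef. *)
  by rewrite {1}p4 !mulA -p5.
split=> //; apply: locally_inverse_of_factorization => e f c he hf.
rewrite (sandwich e f c he hf); split.
- by exists (e * f * c * f * e * f * e * f); rewrite !mulA.
- by exists (e * f * e * f * c * f * e * f); rewrite !mulA.
Qed.

(** The hypothesis is the left one reversed, with the letters a and c exchanged. In [sandwich], c =
    e now yields (ef)^4 and c = f yields (ef)^5. *)
Lemma orthodox_locally_inverse_of_right_sandwich :
  (forall a c d : S, d * c * d * d * c * d * a * d * c * c * d * c * c
     = d * d * a * c * c) ->
  orthodox S /\ locally_inverse S.
Proof.
move=> hyp.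
have sandwich (e f c : S) : idempotent_elt e -> idempotent_elt f ->
    e * c * f = e * f * e * f * e * c * e * f * e * f.
  move=> he hf; have := hyp c f e.
  have he' x : x * e * e = x * e by rewrite -mulA he.
  have hf' x : x * f * f = x * f by rewrite -mulA hf.
  by rewrite he !he' !hf'.
have orth : orthodox S.
  move=> e f he hf.
  have := sandwich e f e he hf; have := sandwich e f f he hf.
  have he' x : x * e * e = x * e by rewrite -mulA he.
  have hf' x : x * f * f = x * f by rewrite -mulA hf.
  rewrite !he' he -mulA hf => p5 p4; rewrite /idempotent_elt.
  by rewrite {1}p4 !mulA -p5.
split=> //; apply: locally_inverse_of_factorization => e f c he hf.
rewrite (sandwich e f c he hf); split.
- by exists (e * f * e * c * e * f * e * f); rewrite !mulA.
- by exists (e * f * e * f * e * c * e * f); rewrite !mulA.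
Qed.

Lemma strict_orthogroup_of_YBE_add :
  YBE_solution (associated_map (star_add star) star) ->
  completely_regular S /\ orthodox S /\ locally_inverse S.
Proof.
move=> hr; split.
  apply: completely_regular_of_square_factor => c.
  (* The triple is (c, c, c); c c^* c = c brings the third component to the form c = c c s. *)
  have := hr (c, star (star c), c).
  rewrite /= /star_add ?starM ?starK !mulA => -[_ _].
  by rewrite !mul_starK -!mulA => e; eexists; rewrite -mulA; exact: e.
apply: orthodox_locally_inverse_of_left_sandwich => a c d.
have := hr (a, star d, c).
by rewrite /= /star_add ?starM ?starK !mulA => -[-> _ _].
Qed.

Lemma strict_orthogroup_of_YBE_oplus :
  YBE_solution (associated_map (star_oplus star) star) ->
  completely_regular S /\ orthodox S /\ locally_inverse S.
Proof.
move=> hr; split.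
  apply: completely_regular_of_square_factor => c.
  (* Reversal makes the first component give x in S x x; [star] carries this to the other side. *)
  suff left_factor (x : S) : exists s, x = s * (x * x).
    have [s es] := left_factor (star c).
    by exists (star s); rewrite -{1}[c]starK es !starM !starK.
  have := hr (x, star (star x), x).
  rewrite /= /star_oplus ?starM ?starK !mulA => -[+ _ _].
  have mulA_starK y : y * x * star x * x = y * x.
    by rewrite -!mulA [x * (star x * x)]mulA mul_starK.
  by rewrite mulA_starK !mul_starK -mulA => /esym e; eexists; exact: e.
apply: orthodox_locally_inverse_of_right_sandwich => a c d.
have := hr (a, star d, c).
by rewrite /= /star_oplus ?starM ?starK !mulA => -[_ _ ->].
Qed.

(** With trivial [star], S is commutative and x x x = x, so only the parity of each positive
    exponent in a word matters. Both sums then equal the product, so one [add] serves both cases. *)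
Lemma YBE_of_star_trivial (add : S -> S -> S) :
  (forall x : S, x = star x) ->
  (forall x y : S, add x y = x * y) ->
  YBE_solution (associated_map add star).
Proof.
move=> hid hadd.
have mulC (x y : S) : x * y = y * x by rewrite {1}[x * y]hid starM -!hid.
have cube (x : S) : x * x * x = x by rewrite -[RHS]mul_starK -hid.
have mulAC (x y z : S) : x * y * z = x * z * y by rewrite -!mulA [y * z]mulC.
have cubeA (x y : S) : x * y * y * y = x * y.
  by rewrite -!mulA [y * (y * y)]mulA cube.
case=> [[a b] c]; rewrite /= !hadd -!hid !mulA.
(* Rewriting with these rules sorts every word into the form a..ab..bc..c. *)
have sort := (mulC b a, mulC c a, mulC c b,
  fun x => mulAC x b a, fun x => mulAC x c a, fun x => mulAC x c b).
by rewrite !sort ?cubeA ?cube.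
Qed.

End RegularStarSemigroup.

Theorem proposition4p2 (S : magmaType) (star : S -> S)
    (hS : regular_star_semigroup star) :
  ((YBE_solution (associated_map (star_add star) star) ->
      completely_regular S /\ orthodox S /\ locally_inverse S) /\
   ((forall x : S, x = star x) ->
      YBE_solution (associated_map (star_add star) star))) /\
  ((YBE_solution (associated_map (star_oplus star) star) ->
      completely_regular S /\ orthodox S /\ locally_inverse S) /\
   ((forall x : S, x = star x) ->
      YBE_solution (associated_map (star_oplus star) star))).
Proof.
split; split.
- exact: strict_orthogroup_of_YBE_add.
- by move=> hid; apply: YBE_of_star_trivial => // x y; rewrite /star_add -!hid.
- exact: strict_orthogroup_of_YBE_oplus.
- move=> hid; apply: YBE_of_star_trivial => // x y.
  by rewrite /star_oplus -(rss_antimul hS) -hid.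
Qed.
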